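(* Let $D$ be a noncommutative (associative) division ring with center $F$, and let $a\in D$ be an element algebraic over $F$ whose minimal polynomial $\lambda(x)\in F[x]$ over $F$ has degree $n>2$. Then there exists a quadratic polynomial $P(x)\in D[x]$ such that: 1. $P(x)$ has infinitely many roots in the conjugacy class $[a]$; 2. there are infinitely many elements of $[a]$ which are not roots of $P(x)$; 3. $\lambda(x)$ does not divide $P(x)$ in $D[x]$.
   Context: For a division ring $D$, $D[x]$ denotes the ring of polynomials in one variable $x$ over $D$, where $x$ commutes with every element of $D$, so that $(\sum_i a_i x^i)(\sum_j b_j x^j)=\sum_k\big(\sum_{i+j=k}a_ib_j\big)x^k$. Polynomials are written with coefficients on the left, and for $P(x)=a_nx^n+\dots+a_1x+a_0\in D[x]$ and $a\in D$ one defines $P(a):=a_na^n+\dots+a_1a+a_0$. An element $a\in D$ is a (right) root of $P(x)$ if $P(a)=0$. The conjugacy class of $a\in D$ is $[a]:=\{dad^{-1}\mid d\in D\setminus\{0\}\}$. A quadratic polynomial is a polynomial of degree $2$. Since $\lambda(x)$ has coefficients in the center $F$, it is central in $D[x]$, so left and right divisibility by $\lambda(x)$ coincide. *)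

(* Defs.v *)
From HB Require Import structures.
From mathcomp Require Import all_boot all_order all_algebra.
From mathcomp Require Import classical_sets cardinality.

Set Implicit Arguments.
Unset Strict Implicit.
Unset Printing Implicit Defensive.

Import GRing.Theory.
Local Open Scope classical_set_scope.
Local Open Scope ring_scope.

(* MathComp has no structure for (possibly noncommutative) division rings; a
   [unitRingType] is a nontrivial associative unital ring with inverses of
   units. *)
Definition division_ring (D : unitRingType) : Prop :=
  forall x : D, x != 0 -> x \is a GRing.unit.

Definition center (D : unitRingType) : set D :=
  [set z | forall x : D, GRing.comm z x].

Definition center_poly (D : unitRingType) (p : {poly D}) : Prop :=
  forall i : nat, center p`_i.

(* Existence of such a [lam] expresses that [a] is algebraic over the center.
   The library evaluation [p.[a]] is by the Horner scheme with coefficients on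
   the left, i.e. [\sum_i p`_i * a ^+ i] (lemma [horner_coef]), also over a
   noncommutative ring. *)
Definition is_center_minpoly (D : unitRingType) (a : D) (lam : {poly D}) : Prop :=
  [/\ lam \is monic, center_poly lam, root lam a &
      forall q : {poly D}, center_poly q -> q != 0 -> root q a ->
        (size lam <= size q)%N].

Definition conj_class (D : unitRingType) (a : D) : set D :=
  [set b | exists2 d : D, d != 0 & b = d * a * d^-1].

(* Left and right divisibility agree for a divisor with central coefficients,
   the only case used. *)
Definition poly_divides (D : unitRingType) (p q : {poly D}) : Prop :=
  exists r : {poly D}, q = r * p.

(* Main.v *)
Require Import Defs.
From HB Require Import structures.
From mathcomp Require Import all_boot all_order all_algebra all_field.
From mathcomp Require Import boolp classical_sets cardinality.

Set Implicit Arguments.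
Unset Strict Implicit.
Unset Printing Implicit Defensive.

Import GRing.Theory.
Local Open Scope classical_set_scope.
Local Open Scope ring_scope.

(* For d != 0, the conjugate d a d^-1 is a root of P = \sum_i p_i x^i iff d lies
   in V_P = {d | \sum_i p_i d a^i = 0}, a right subspace of D over the centralizer
   C of a; moreover d and d' give the same conjugate iff they span the same line.
   Pick d not commuting with a and put e = d a - a d and
   P = (x - e a e^-1)(x - a), so that 1 and d belong to V_P. A nonzero polynomial
   of minimal degree vanishing on the whole class [a] is central up to a scalar,
   so V_P <> D because deg P < n. If C is infinite, the elements d + c (c in C)
   give infinitely many roots, and the elements w + v (v in V_P), for a fixed w
   outside V_P, infinitely many nonroots.
   If C were finite, then V_Q would be finite for every Q != 0, by induction on
   deg Q, since V_(Q(x-b)) is the preimage of V_Q under d |-> d a - b d, whose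
   kernel is finite. As V_lam = D, D would be finite, hence commutative by
   Wedderburn's theorem. *)

Lemma finite_division_ring_comm (D : unitRingType) :
  division_ring D -> finite_set [set: D] -> forall x y : D, x * y = y * x.
Proof.
move=> hD /finite_seqP[s hs].
(* The duplicate-free enumeration [undup s] yields the countable and finite structures that put
   Wedderburn's theorem [finDomain_mulrC] within reach. *)
have mem_s x : x \in undup s.
  by rewrite mem_undup; have : [set: D] x by []; rewrite hs.
have pickleK : pcancel (index^~ (undup s)) (nth None (map some (undup s))).
  by move=> x; rewrite (nth_map x) ?index_mem// nth_index.
have fin_s : Finite.axiom (undup s).
  by move=> x; rewrite count_uniq_mem ?undup_uniq// mem_s.
pose cD := Choice_isCountable.Build D pickleK.
pose fD := isFinite.Build D fin_s.
pose F : finUnitRingType := HB.pack D cD fD.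
apply: (@finDomain_mulrC F) => x y xy0.
have [//|/hD ux] := eqVneq (x : D) 0.
by rewrite -[y : D](mulKr ux) [X in _ * X]xy0 mulr0 eqxx.
Qed.

(** Evaluation at [a] kills left multiples of X - a, and (X - b) d = d (X - a) + (d a - b d). *)
Lemma hornerM_XsubC_C (D : unitRingType) (a b d : D) (q : {poly D}) :
  (q * ('X - b%:P) * d%:P).[a] = (q * (d * a - b * d)%:P).[a].
Proof.
have -> : q * ('X - b%:P) * d%:P =
    q * d%:P * ('X - a%:P) + q * (d * a - b * d)%:P.
  rewrite -!mulrA -mulrDr; congr (_ * _).
  by rewrite mulrBl mulrBr polyCB !polyCM commr_polyX addrA subrK.
rewrite hornerD hornerM_comm; last first.
  by rewrite /comm_poly hornerXsubC subrr mulr0 mul0r.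
by rewrite hornerXsubC subrr mulr0 add0r.
Qed.

(** Divide [p] by X - b on the right, with b = d a d^-1. Since d a = b d, the quotient term vanishes
    and only the remainder p(b) survives. *)
Lemma hornerMC_conj (D : unitRingType) (a d : D) (p : {poly D}) :
  d \is a GRing.unit -> (p * d%:P).[a] = p.[d * a * d^-1] * d.
Proof.
move=> ud; set b := d * a * d^-1.
have /factor_theorem[q hq] : root (p - p.[b]%:P) b.
  by rewrite rootE hornerD hornerN hornerC subrr.
rewrite -[p in LHS](subrK p.[b]%:P) hq mulrDl -polyCM hornerD hornerC.
by rewrite hornerM_XsubC_C divrK// subrr polyC0 mulr0 horner0 add0r.
Qed.

(* [(p * d%:P).[a]] is [\sum_i p`_i * d * a ^+ i]. *)
Definition zero_space (D : unitRingType) (a : D) (p : {poly D}) : set D :=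
  [set d | (p * d%:P).[a] = 0].

Lemma zero_spaceB (D : unitRingType) (a : D) (p : {poly D}) (u v : D) :
  zero_space a p u -> zero_space a p v -> zero_space a p (u - v).
Proof.
by rewrite /zero_space/= polyCB mulrBr hornerD hornerN => -> ->; rewrite subrr.
Qed.

Lemma zero_spaceM (D : unitRingType) (a : D) (p : {poly D}) (u c : D) :
  zero_space a p u -> GRing.comm c a -> zero_space a p (u * c).
Proof.
rewrite /zero_space/= => pu ca.
by rewrite polyCM mulrA hornerM_comm ?pu ?mul0r // /comm_poly hornerC.
Qed.

Lemma zero_space_root (D : unitRingType) (a d : D) (p : {poly D}) :
  d \is a GRing.unit -> zero_space a p d <-> root p (d * a * d^-1).
Proof.
move=> ud; rewrite /zero_space/= hornerMC_conj// rootE; split=> [h|/eqP ->].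
  by rewrite -(mulrK ud p.[_]) h mul0r.
by rewrite mul0r.
Qed.

Lemma zero_space_finite (D : unitRingType) (a : D) (p : {poly D}) :
  division_ring D -> finite_set [set c : D | GRing.comm c a] -> p != 0 ->
  finite_set (zero_space a p).
Proof.
move=> hD finC; have [m] := ubnP (size p).
elim: m p => // m IH p; rewrite ltnS => sp p0.
have [[d0 d0n0 pd0]|none] := pselect (exists2 d, d != 0 & zero_space a p d);
  last first.
  apply: (@sub_finite_set _ _ [set 0]) => // d pd.
  by apply/eqP; apply: contrapT => /negP d0; apply: none; exists d.
have ud0 := hD _ d0n0.
have /(zero_space_root _ _ ud0)/factor_theorem[q pq] := pd0.
set b := d0 * a * d0^-1 in pq.
have q0 : q != 0 by apply: contraNneq p0 => q0; rewrite pq q0 mul0r.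
have finq : finite_set (zero_space a q).
  by apply: IH (q0); move: sp; rewrite pq size_Mmonic ?monicXsubC// size_XsubC addn2.
(* If d a = b d, then d0^-1 d centralizes [a], so the kernel lies in d0 times the centralizer. *)
have finK : finite_set [set d | d * a - b * d = 0].
  apply: sub_finite_set (finite_image ( *%R d0) finC) => d /= /subr0_eq da.
  exists (d0^-1 * d); last by rewrite mulVKr.
  by rewrite /GRing.comm -mulrA da /b !mulrA mulVr// mul1r.
apply: (@sub_finite_set _ _
  (\bigcup_(w in zero_space a q) [set d | d * a - b * d = w])).
  move=> d; rewrite /zero_space/= pq hornerM_XsubC_C => qd.
  by exists (d * a - b * d).
apply: bigcup_finite => // w _.
(* A fibre is empty or a translate of the kernel. *)
have [[d1 d1w]|none] := pselect (exists d, d * a - b * d = w);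
  last first.
  by apply: (@sub_finite_set _ _ set0) => // d /= dw; case: none; exists d.
apply: sub_finite_set (finite_image (+%R d1) finK) => d /= dw.
exists (d - d1); last by rewrite addrC subrK.
by rewrite mulrBl mulrBr opprD addrACA dw -opprD d1w subrr.
Qed.

(** Scale [p] to a monic [Q]. If [Q] is central, minimality of [lam] applies. Otherwise some
    commutator x Q - Q x is nonzero; its leading terms cancel and its zero space is still full, so
    induction applies. *)
Lemma zero_space_full_size (D : unitRingType) (a : D) (lam p : {poly D}) :
  division_ring D -> is_center_minpoly a lam -> p != 0 ->
  zero_space a p = setT -> (size lam <= size p)%N.
Proof.
move=> hD [_ _ _ lam_min]; have [m] := ubnP (size p).
elim: m p => // m IH p; rewrite ltnS => sp p0 pT.
have ul : lead_coef p \is a GRing.unit by apply: hD; rewrite lead_coef_eq0.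
pose Q : {poly D} := (lead_coef p)^-1 *: p.
have Qi i : Q`_i = (lead_coef p)^-1 * p`_i by rewrite coefZ.
have sQ : size Q = size p.
  apply/eqP; rewrite eqn_leq size_scale_leq /=.
  by rewrite -[X in (size (polyseq X) <= _)%N]scale1r -(mulrV ul) -scalerA
    size_scale_leq.
have Q0 : Q != 0 by rewrite -size_poly_gt0 sQ size_poly_gt0.
have QT d : (Q * d%:P).[a] = 0.
  have : zero_space a p d by rewrite pT.
  by rewrite /zero_space/= -scalerAl hornerZ => ->; rewrite mulr0.
rewrite -sQ; have [cQ|] := pselect (center_poly Q).
  by apply: lam_min => //; rewrite rootE -[Q]mulr1 -[1]/(1%:P) QT.
move=> /existsNP[i /existsNP[x /eqP xQ]].
pose R := x%:P * Q - Q * x%:P.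
have R0 : R != 0.
  apply: contraNneq xQ => R0; have : R`_i = 0 by rewrite R0 coef0.
  by rewrite coefB coefCM coefMC => /subr0_eq ->.
have sR : (size R < size p)%N.
  have p_gt0 : (0 < size p)%N by rewrite size_poly_gt0.
  rewrite -(prednK p_gt0) ltnS; apply/leq_sizeP => j hj.
  rewrite coefB coefCM coefMC.
  move: hj; rewrite leq_eqVlt => /predU1P[<-|hj].
    by rewrite Qi -lead_coefE mulVr// mulr1 mul1r subrr.
  by rewrite nth_default ?mulr0 ?mul0r ?subrr// sQ -(prednK p_gt0).
apply: leq_trans (IH R (leq_trans sR sp) R0 _) _; last by rewrite sQ ltnW.
apply/seteqP; split=> // d _; rewrite /zero_space/= mulrBl hornerD hornerN.
by rewrite -!mulrA -polyCM QT subr0 mul_polyC hornerZ QT mulr0.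
Qed.

(** If w + u and w + v give the same conjugate, then c = (w + v)^-1 (w + u) centralizes [a], and w
    (1 - c) = v c - u lies in [S]. As [w] does not, c = 1 and u = v. *)
Lemma infinite_conj_translate (D : unitRingType) (a w : D) (S : set D) :
  division_ring D -> infinite_set S ->
  (forall u v, S u -> S v -> S (u - v)) ->
  (forall u c, S u -> GRing.comm c a -> S (u * c)) ->
  ~ S w ->
  infinite_set [set (w + u) * a * (w + u)^-1 | u in S].
Proof.
move=> hD infS SB SM Sw.
have S0 u : S u -> S 0 by move=> Su; rewrite -(subrr u); apply: SB.
have SN u : S u -> S (- u).
  by move=> Su; rewrite -sub0r; apply: SB => //; apply: S0 Su.
have wu u : S u -> w + u \is a GRing.unit.
  move=> Su; apply: hD; apply: contra_notN Sw; rewrite addr_eq0 => /eqP ->.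
  exact: SN.
rewrite (eq_finite_set (inj_card_eq _))// => u v /set_mem Su /set_mem Sv euv.
pose c := (w + v)^-1 * (w + u).
have cE : (w + v) * c = w + u by rewrite mulVKr// wu.
have ca : GRing.comm c a.
  apply: (mulrI (wu _ Sv)); rewrite mulrA cE [RHS]mulrA.
  rewrite /c [RHS]mulrA -euv divrK//; exact: wu.
have Sw1c : S (w * (1 - c)).
  have -> : w * (1 - c) = v * c - u.
    apply/eqP; rewrite mulrBr mulr1 subr_eq addrC addrA -mulrDl.
    by rewrite cE addrK.
  by apply: SB => //; apply: SM.
have [c1|c1] := eqVneq (1 - c) 0.
  by move/subr0_eq: c1 cE => <-; rewrite mulr1 => /addrI.
have u1c := hD _ c1.
case: Sw; rewrite -(mulrK u1c w); apply: SM => //.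
apply/commr_sym/commrV; apply: commrB; [exact: commr1|exact: commr_sym].
Qed.

Theorem theorem3 (D : unitRingType) (hD : division_ring D)
    (hnc : ~ (forall x y : D, x * y = y * x))
    (a : D) (lam : {poly D}) (hlam : is_center_minpoly a lam)
    (n : nat) (hdeg : size lam = n.+1) (hn : (2 < n)%N) :
  exists P : {poly D},
    [/\ size P = 3%N,
        infinite_set (conj_class a `&` [set b | root P b]),
        infinite_set (conj_class a `&` [set b | ~ root P b]) &
        ~ poly_divides lam P].
Proof.
have [lam_monic lamC lam_a lam_min] := hlam.
have [d da] : exists d, ~ GRing.comm d a.
  apply/existsNP => aC.
  (* Were [a] central, X - a would be a central polynomial of degree 1 < n with root [a]. *)
  have : (size lam <= size ('X - a%:P)%R)%N.
    apply: lam_min; rewrite ?polyXsubC_eq0 ?root_XsubC ?monic_neq0 ?monicXsubC//.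
    move=> i x; rewrite coefB coefX coefC; apply/commr_sym/commrB.
      by case: eqP => _; [apply: commr1|apply: commr0].
    by case: eqP => _; [apply: aC|apply: commr0].
  by rewrite hdeg size_XsubC; case: n hn {hdeg} => [|[]].
set C := [set c | GRing.comm c a] in da *.
have infC : infinite_set C.
  move=> finC; apply/hnc/finite_division_ring_comm => //.
  apply: sub_finite_set (zero_space_finite hD finC (monic_neq0 lam_monic)).
  move=> x _; rewrite /zero_space/=.
  have -> : lam * x%:P = x%:P * lam.
    by apply/polyP => i; rewrite coefMC coefCM; apply: lamC.
  by rewrite mul_polyC hornerZ (rootP lam_a) mulr0.
pose e := d * a - a * d.
have e0 : e != 0 by apply: contra_notN da => /eqP/subr0_eq.
have ue := hD _ e0.
pose P := ('X - (e * a * e^-1)%:P) * ('X - a%:P).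
have sP : size P = 3%N.
  by rewrite size_Mmonic ?monic_neq0 ?monicXsubC// !size_XsubC.
have P0 : P != 0 by rewrite -size_poly_gt0 sP.
pose V := zero_space a P.
have V1 : V 1.
  rewrite /V /zero_space /= hornerM_XsubC_C mul1r mulr1 subrr.
  by rewrite polyC0 mulr0 horner0.
(* The factor X - a sends [d] to [e], which the factor X - e a e^-1 kills. *)
have Vd : V d.
  rewrite /V /zero_space /= hornerM_XsubC_C -/e.
  by rewrite hornerMC_conj// hornerXsubC subrr mul0r.
have CV : C `<=` V by move=> c Cc; rewrite -[c]mul1r; apply: zero_spaceM.
have [w Vw] : exists w, ~ V w.
  apply/existsNP => VT; have : (size lam <= size P)%N.
    by apply: (zero_space_full_size hD hlam) => //; apply/seteqP; split=> // x _;
    apply: VT.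
  by rewrite sP hdeg ltnS leqNgt hn.
have VB u v : V u -> V v -> V (u - v) by apply: zero_spaceB.
have VD u v : V u -> V v -> V (u + v).
  move=> Vu Vv; rewrite -[v]opprK -[- v]sub0r; apply/VB/VB => //.
  by rewrite -(subrr v); apply: VB.
exists P; split=> //.
(* Here the subspace is [C] itself, which misses [d], while d + C stays inside [V]. *)
- have infR : infinite_set [set (d + u) * a * (d + u)^-1 | u in C].
    apply: infinite_conj_translate => //.
      by move=> u v ua va; apply/commr_sym/commrB; apply: commr_sym.
    by move=> u c ua ca; apply/commr_sym/commrM; apply: commr_sym.
  apply: contra_not infR; apply: sub_finite_set => _ [u Cu <-].
  have du0 : d + u != 0.
    apply: contra_notN da; rewrite addr_eq0 => /eqP ->.
    exact/commr_sym/commrN/commr_sym.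
  split; first by exists (d + u).
  by apply/zero_space_root; [exact: hD|apply: VD => //; apply: CV].
- have infN : infinite_set [set (w + u) * a * (w + u)^-1 | u in V].
    apply: infinite_conj_translate => //.
      by move=> finV; apply: infC; apply: sub_finite_set finV.
    by move=> u c; apply: zero_spaceM.
  apply: contra_not infN; apply: sub_finite_set => _ [u Vu <-].
  have Vwu : ~ V (w + u) by move=> h; apply: Vw; rewrite -(addrK u w); apply: VB.
  have wu0 : w + u != 0.
    by apply: contra_notN Vwu => /eqP ->; rewrite -(subrr 1); apply: VB.
  split; first by exists (w + u).
  by move=> /(zero_space_root _ _ (hD _ wu0)).
(* A nonzero left multiple of the monic [lam] has degree at least n > 2. *)
- move=> [r Pr].
  have r0 : r != 0 by apply: contraNneq P0 => r0; rewrite Pr r0 mul0r.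
  move: sP; rewrite Pr size_Mmonic// hdeg addnS /= => sn.
  by rewrite -size_poly_gt0 in r0; have := leq_add r0 hn; rewrite sn.
Qed.
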